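(* For every integer $n \geq 1$ there exists an antichain $A \subseteq [0,1]^n$ (with respect to the coordinatewise partial order) whose $(n-1)$-dimensional Hausdorff measure is exactly $n$, i.e. $\mathcal{H}^{n-1}(A) = n$.
   Context: Partial order: for $\mathbf{x}, \mathbf{y} \in [0,1]^n$, write $\mathbf{x} \leq \mathbf{y}$ if $x_i \leq y_i$ for each $i = 1, \dots, n$. A subset $A \subseteq [0,1]^n$ is an antichain if it contains no two distinct elements $\mathbf{x}, \mathbf{y}$ with $\mathbf{x} \leq \mathbf{y}$. Hausdorff measure (normalization): for real $s \geq 0$ let $\alpha_s = \frac{\pi^{s/2}}{2^s\,\Gamma(s/2+1)}$ (the volume of the $s$-dimensional Euclidean ball of radius $1/2$). Let $\operatorname{diam}$ denote diameter with respect to the Euclidean metric on $\mathbb{R}^n$. For $\delta > 0$ and $A \subseteq \mathbb{R}^n$, set $$\mathcal{H}^s_\delta(A) = \alpha_s \inf\left\{ \sum_{i=1}^\infty \operatorname{diam}(U_i)^s : A \subseteq \bigcup_{i=1}^\infty U_i \text{ and } \operatorname{diam}(U_i) \leq \delta \text{ for each } i \right\},$$ and $\mathcal{H}^s(A) = \lim_{\delta \to 0^+} \mathcal{H}^s_\delta(A)$. With the usual conventions (empty sets in the cover contribute $0$, and $\operatorname{diam}(U)^0 = 1$ for non-empty $U$), $\mathcal{H}^0$ is the counting measure. With this scaling, $\mathcal{H}^n$ agrees with Lebesgue measure on $\mathbb{R}^n$. *)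

(* Defs.v *)
From HB Require Import structures.
From mathcomp Require Import all_boot all_order all_algebra.
From mathcomp Require Import all_classical all_reals all_analysis.
Set Implicit Arguments.
Unset Strict Implicit.
Unset Printing Implicit Defensive.
Import Order.TTheory GRing.Theory Num.Theory.
Import numFieldNormedType.Exports.
Local Open Scope classical_set_scope.
Local Open Scope ring_scope.

Definition unit_cube (R : realType) (n : nat) : set 'rV[R]_n :=
  [set x | forall i : 'I_n, 0 <= x ord0 i <= 1].
Arguments unit_cube R n : clear implicits.

Definition coord_le (R : realType) (n : nat) (x y : 'rV[R]_n) : Prop :=
  forall i : 'I_n, x ord0 i <= y ord0 i.

Definition antichain (R : realType) (n : nat) (A : set 'rV[R]_n) : Prop :=
  forall x y : 'rV[R]_n, A x -> A y -> x <> y -> ~ coord_le x y.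

(* The library norm on row vectors is the sup norm, hence this definition. *)
Definition euclid_norm (R : realType) (n : nat) (x : 'rV[R]_n) : R :=
  Num.sqrt (\sum_(i < n) x ord0 i ^+ 2).

(* The maximum with 0 only matters for the empty set, where ereal_sup is -oo. *)
Definition diam (R : realType) (n : nat) (U : set 'rV[R]_n) : \bar R :=
  maxe 0%E (ereal_sup [set (euclid_norm (p.1 - p.2))%:E | p in U `*` U]).

(* diam(U)^s with the conventions used for Hausdorff measures: the empty set
   contributes 0 even for s = 0, and a nonempty set contributes 1 for s = 0
   (poweR x 0 = 1 for every x, including x = 0). *)
Definition diam_pow (R : realType) (n : nat) (s : R) (U : set 'rV[R]_n) :
    \bar R :=
  if U == set0 then 0%E else poweR (diam U) s.

Definition Gamma (R : realType) (z : R) : R :=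
  \int[@lebesgue_measure R]_(t in `]0, +oo[) (t `^ (z - 1) * expR (- t)).

(* The volume of the s-dimensional Euclidean ball of radius 1/2. *)
Definition ball_volume (R : realType) (s : R) : R :=
  pi `^ (s / 2) / (2 `^ s * Gamma (s / 2 + 1)).

Definition delta_cover (R : realType) (n : nat) (delta : R)
    (A : set 'rV[R]_n) : set (nat -> set 'rV[R]_n) :=
  [set U | A `<=` \bigcup_i U i /\ forall i, (diam (U i) <= delta%:E)%E].

Definition hausdorff_content (R : realType) (n : nat) (s delta : R)
    (A : set 'rV[R]_n) : \bar R :=
  ((ball_volume s)%:E *
   ereal_inf [set (\sum_(0 <= i <oo) diam_pow s (U i))%E
             | U in delta_cover delta A])%E.

Definition hausdorff_measure (R : realType) (n : nat) (s : R)
    (A : set 'rV[R]_n) : \bar R :=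
  lim (hausdorff_content s delta A @[delta --> 0^'+]).

(* Main.v *)
Require Import Defs.
From HB Require Import structures.
From mathcomp Require Import all_boot all_order all_algebra.
From mathcomp Require Import all_classical all_reals all_analysis.
From mathcomp Require Import measurable_realfun.
From mathcomp Require Import ring lra zify.
Import Order.TTheory GRing.Theory Num.Theory.
Import numFieldNormedType.Exports.
Local Open Scope classical_set_scope.
Local Open Scope ring_scope.
Set Implicit Arguments.
Unset Strict Implicit.
Unset Printing Implicit Defensive.

(* An exact value comes for free from homogeneity: if A is an antichain of the
   cube with n <= H^(n-1)(A) < +oo, then n > 1 allows one to shrink A by a
   factor lam <= 1 with lam^(n-1) = n / H^(n-1)(A). Finiteness holds for every
   antichain of the cube, so it remains to find one with H^(n-1)(A) >= n.

   Each level k cuts every cell of level k - 1 into cells indexed by the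
   integers in increasing order, the cell of index 0 having relative length
   1 - 1/(k+2). Almost every point of (0, 1) thus has a sequence of integer
   digits, and the order of (0, 1) is the lexicographic one. Let A be the set of
   points whose n coordinates have digits summing to 1 at every level; it is an
   antichain. Fix k and let K_j be the set of points of A whose coordinates
   other than the j-th have k-th digit 0. The j-th one then has k-th digit 1, so
   the K_j are disjoint (and at positive distance after a small shrinking),
   while the projection of K_j along the j-th axis has Lebesgue measure at least
   (1 - 1/(k+2))^(n-1). The isodiametric inequality bounds the Hausdorff measure
   of each K_j from below by that of its projection. *)

(** * Volume of balls *)

Section affine_change_of_variable.
Variables (R : realType) (u w : R).
Hypothesis w_gt0 : 0 < w.
Notation mu := (@lebesgue_measure R).

Let affine : measurableTypeR R -> measurableTypeR R := fun x => u + w * x.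

Let measurable_affine : measurable_fun setT affine.
Proof. exact: measurable_funD. Qed.

Let image_measure : {measure set measurableTypeR R -> \bar R} :=
  mscale (NngNum (ltW w_gt0))
    (measure_function_pushforward__canonical__measure_function_Measure
       mu measurable_affine).

(** The scaled pushforward [image_measure] gives each interval []a, b]] its length, so it is
    Lebesgue measure by uniqueness. *)
Lemma lebesgue_measure_affine (A : set R) : measurable A ->
  mu A = (w%:E * mu [set x : R | A (u + w * x)%R])%E.
Proof.
move=> mA; apply: (@lebesgue_measure_unique R image_measure) => //.
move=> _ [[a b]] _ <-; rewrite [RHS]/= /mscale/= /pushforward.
rewrite [X in (_ = _ * mu X)%E](_ : _ = `](a - u) / w, (b - u) / w]%classic);
  last first.
  apply/seteqP; split => x /=; rewrite /affine !in_itv/= => /andP[ax xb].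
    by rewrite ltr_pdivrMr// ler_pdivlMr// ltrBlDl lerBrDl mulrC ax xb.
  move: ax xb; rewrite ltr_pdivrMr// ler_pdivlMr// ltrBlDl lerBrDl mulrC.
  by move=> -> ->.
rewrite !lebesgue_measure_itv/= !lte_fin ltr_pM2r ?invr_gt0// ltrD2r.
case: ifP => ab; last by rewrite mule0.
by rewrite -!EFinD -EFinM; congr EFin; field; exact: lt0r_neq0.
Qed.

Lemma ge0_integral_affine (f : R -> \bar R) :
  measurable_fun setT f -> (forall x, 0 <= f x)%E ->
  (\int[mu]_x f x = w%:E * \int[mu]_x f (u + w * x)%R)%E.
Proof.
move=> mf f0; transitivity (\int[image_measure]_x f x)%E.
  by apply: eq_measure_integral => /= A mA _; exact: lebesgue_measure_affine.
rewrite ge0_integral_mscale//; congr (_ * _)%E.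
exact: (@ge0_integral_pushforward _ _ _ _ R _ measurable_affine).
Qed.

End affine_change_of_variable.

Section ball_volume_recursion.
Variable R : realType.
Notation mu := (@lebesgue_measure R).
Local Open Scope ereal_scope.

(* The volume of the [m]-ball of radius [sqrt t], by slices y = const. *)
Fixpoint ball_vol (m : nat) (t : R) : \bar R :=
  if m is m'.+1 then \int[mu]_y ball_vol m' (t - y ^+ 2)%R
  else ((0 <= t)%R%:R)%:E.

Lemma ball_vol_ge0 m t : 0 <= ball_vol m t.
Proof.
by elim: m t => [|m IH] t /=; [rewrite lee_fin|apply: integral_ge0 => y _].
Qed.

Let measurable_sub_sqr : measurable_fun setT
  (fun z : measurableTypeR R * measurableTypeR R => (z.1 - z.2 ^+ 2)%R : R).
Proof.
apply: measurable_funB; first exact: measurable_fst.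
by apply: measurable_funX; exact: measurable_snd.
Qed.

Lemma measurable_ball_vol m : measurable_fun setT (ball_vol m).
Proof.
elim: m => [|m IH] /=.
  apply/measurable_EFinP.
  rewrite (_ : (fun t : R => _) = \1_`[0%R, +oo[); last first.
    by apply/funext => t; rewrite indicE mem_setE in_itv/= andbT.
  exact: measurable_indic.
pose f (z : measurableTypeR R * measurableTypeR R) :=
  ball_vol m (z.1 - z.2 ^+ 2)%R.
have := @measurable_fun_fubini_tonelli_F _ _ _ _ _ (@lebesgue_measure R) f.
apply; first exact: (measurableT_comp IH).
by move=> z; exact: ball_vol_ge0.
Qed.

Lemma ball_vol_nondecreasing m (s t : R) : (s <= t)%R ->
  ball_vol m s <= ball_vol m t.
Proof.
elim: m s t => [|m IH] s t st /=.
  rewrite lee_fin ler_nat; case: (leP 0%R s) => // s0.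
  by rewrite (le_trans s0 st).
apply: ge0_le_integral => //= [y _|||y _].
- exact: ball_vol_ge0.
- apply: (measurableT_comp (measurable_ball_vol m)).
  by apply: measurable_funB => //; exact: measurable_funX.
- apply: (measurableT_comp (measurable_ball_vol m)).
  by apply: measurable_funB => //; exact: measurable_funX.
- by apply: IH; rewrite lerD2r.
Qed.

Lemma ball_vol_lt0 m (t : R) : (t < 0)%R -> ball_vol m t = 0.
Proof.
elim: m t => [|m IH] t t0 /=; first by rewrite leNgt t0.
apply: integral0_eq => y _; apply: IH.
by rewrite ltrBlDr (lt_le_trans t0)// add0r sqr_ge0.
Qed.

(** The substitution y = r y' in each slice integral yields one factor [r] per dimension. *)
Lemma ball_vol_scale m (r t : R) : (0 < r)%R ->
  ball_vol m (r ^+ 2 * t)%R = (r ^+ m)%:E * ball_vol m t.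
Proof.
move=> r0; elim: m t => [|m IH] t /=.
  by rewrite mul1e pmulr_rge0// exprn_gt0.
rewrite (@ge0_integral_affine R 0%R r)//; first last.
- by move=> x; exact: ball_vol_ge0.
- apply: (measurableT_comp (measurable_ball_vol m)).
  by apply: measurable_funB => //; exact: measurable_funX.
rewrite (exprS r m) EFinM -muleA; congr (_ * _).
rewrite -ge0_integralZl//=; first last.
- by rewrite lee_fin exprn_ge0// ltW.
- by move=> x _; exact: ball_vol_ge0.
- apply: (measurableT_comp (measurable_ball_vol m)).
  by apply: measurable_funB => //; exact: measurable_funX.
by apply: eq_integral => y _; rewrite -IH add0r exprMn -mulrBr.
Qed.

Let measurable_expRN : measurable_fun setT (fun t : R => (expR (- t))%:E).
Proof. by apply/measurable_EFinP; exact: measurableT_comp. Qed.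

(* Layer-cake form of the m-dimensional Gaussian integral; by homogeneity its
   left-hand side is ball_vol m 1 * Gamma (m / 2 + 1). *)
Lemma integral_ball_vol_expR m :
  \int[mu]_t (ball_vol m t * (expR (- t))%:E) = ((Num.sqrt pi) ^+ m)%:E.
Proof.
elim: m => [|m IH] /=.
  rewrite expr0 -(@integral_exponential_pdf R 1%R)//.
  apply: eq_integral => t _; rewrite /exponential_pdf patchE mem_setE in_itv/= andbT.
  by case: ifPn => _; rewrite ?mul0e// mul1e !mul1r mulN1r.
transitivity (\int[mu]_t \int[mu]_y
    (ball_vol m (t - y ^+ 2)%R * (expR (- t))%:E)).
  apply: eq_integral => t _; rewrite ge0_integralZr//.
    apply: (measurableT_comp (measurable_ball_vol m)).
    by apply: measurable_funB => //; exact: measurable_funX.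
  by move=> y _; exact: ball_vol_ge0.
pose f (z : measurableTypeR R * measurableTypeR R) :=
  ball_vol m (z.1 - z.2 ^+ 2)%R * (expR (- z.1))%:E.
rewrite (@fubini_tonelli _ _ _ _ _ mu mu f); first last.
- by move=> z; rewrite mule_ge0 ?ball_vol_ge0// lee_fin expR_ge0.
- apply: emeasurable_funM; first exact: measurableT_comp (measurable_ball_vol m) _.
  exact: measurableT_comp measurable_expRN measurable_fst.
rewrite (exprSr _ m) EFinM -integralT_gauss -IH -ge0_integralZl//; first last.
- apply: integral_ge0 => t _.
  by rewrite mule_ge0 ?ball_vol_ge0// lee_fin expR_ge0.
- by move=> y _; rewrite lee_fin gauss_fun_ge0.
- by apply/measurable_EFinP; exact: measurable_gauss_fun.
apply: eq_integral => y _; rewrite /f /=.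
(* Translating t by y^2 turns the weight into exp(-t) exp(-y^2), so one Gaussian integral splits off
   and the induction hypothesis applies to the rest. *)
rewrite (@ge0_integral_affine R (y ^+ 2)%R 1%R)//; first last.
- by move=> x; rewrite mule_ge0 ?ball_vol_ge0// lee_fin expR_ge0.
- apply: emeasurable_funM => //.
  apply: (measurableT_comp (measurable_ball_vol m)).
  exact: measurable_funB.
rewrite mul1e -ge0_integralZr//; first last.
- by rewrite lee_fin gauss_fun_ge0.
- by move=> t _; rewrite mule_ge0 ?ball_vol_ge0// lee_fin expR_ge0.
- by apply: emeasurable_funM => //; exact: measurable_ball_vol.
apply: eq_integral => t _; rewrite mul1r addrAC subrr add0r opprD expRD EFinM.
by rewrite [X in _ * X]muleC muleA.
Qed.

End ball_volume_recursion.

Section ball_volume_formula.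
Variable R : realType.
Notation mu := (@lebesgue_measure R).
Local Open Scope ereal_scope.

(** The integral of [Gamma (m / 2 + 1)] with values in the extended reals, so that its finiteness
    can be derived rather than presupposed. *)
Let gamma_integral (m : nat) : \bar R :=
  \int[mu]_(t in `]0%R, +oo[) ((t `^ (m%:R / 2 + 1 - 1)) * expR (- t))%:E.

Let ball_vol_powR m (t : R) : (0 < t)%R ->
  ball_vol m t = ball_vol m 1 * (t `^ (m%:R / 2 + 1 - 1))%:E.
Proof.
move=> t0; have s0 : (0 < Num.sqrt t)%R by rewrite sqrtr_gt0.
rewrite -{1}(sqr_sqrtr (ltW t0)) -(mulr1 (Num.sqrt t ^+ 2)%R) ball_vol_scale//.
rewrite muleC; congr (_ * _%:E).
by rewrite -powR_mulrn ?ltW// -powR12_sqrt ?ltW// -powRrM addrK mulrC.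
Qed.

Let ball_vol1_gamma m :
  ball_vol m (1 : R) * gamma_integral m = ((Num.sqrt pi) ^+ m)%:E.
Proof.
have mexp : measurable_fun setT (fun t : R => (expR (- t))%:E).
  by apply/measurable_EFinP; exact: measurableT_comp.
rewrite -integral_ball_vol_expR.
transitivity (\int[mu]_(t in `[0%R, +oo[) (ball_vol m t * (expR (- t))%:E));
    last first.
  rewrite integral_mkcond; apply: eq_integral => t _.
  rewrite patchE mem_setE in_itv/= andbT; case: ifPn => //.
  by rewrite -ltNge => t0; rewrite ball_vol_lt0 ?mul0e.
rewrite -integral_itv_obnd_cbnd; last first.
  apply: measurable_funTS; apply: emeasurable_funM => //.
  exact: measurable_ball_vol.
rewrite /gamma_integral -ge0_integralZl//.
- apply: eq_integral => t; rewrite inE/= in_itv/= andbT => t0.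
  by rewrite (ball_vol_powR _ t0) EFinM muleA.
- apply/measurable_EFinP; apply: measurable_funM.
    by apply: measurable_funTS; exact: measurable_powR.
  by apply: measurable_funTS; exact: measurableT_comp.
- by move=> t _; rewrite lee_fin mulr_ge0 ?powR_ge0 ?expR_ge0.
- exact: ball_vol_ge0.
Qed.

Lemma ball_vol1E m :
  ball_vol m (1 : R) = (2 ^+ m * ball_volume (m%:R : R))%:E.
Proof.
have := ball_vol1_gamma m.
have V0 := ball_vol_ge0 m (1 : R).
have I0 : 0 <= gamma_integral m.
  by apply: integral_ge0 => t _; rewrite lee_fin mulr_ge0 ?powR_ge0 ?expR_ge0.
have p0 : (0 < Num.sqrt pi ^+ m :> R)%R by rewrite exprn_gt0// sqrtr_gt0 pi_gt0.
have -> : ball_volume (m%:R : R) =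
    (Num.sqrt pi ^+ m / (2 ^+ m * fine (gamma_integral m)))%R.
  rewrite /ball_volume; congr (_ / (_ * _))%R; last by rewrite powR_mulrn.
  by rewrite mulrC powRrM powR12_sqrt ?pi_ge0// powR_mulrn.
(* The product of the two factors is finite and positive, which excludes an infinite factor and a
   zero one. *)
move: (gamma_integral m) (ball_vol m 1) V0 I0 => [I| |] [V| |]//=.
- rewrite !lee_fin -EFinM => V0 I0 -[VI].
  have I_gt0 : (0 < I)%R.
    rewrite lt_neqAle I0 andbT; apply/eqP => I00.
    by move: p0; rewrite -VI -I00 mulr0 ltxx.
  congr EFin; rewrite -VI; field.
  by rewrite !lt0r_neq0// exprn_gt0.
- move=> _; rewrite lee_fin le_eqVlt => /predU1P[<-|I0].
    by rewrite mule0 => -[p00]; move: p0; rewrite -p00 ltxx.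
  by rewrite gt0_mulye.
- rewrite lee_fin le_eqVlt => /predU1P[<-|V0] _; last by rewrite gt0_muley.
  by rewrite mul0e => -[p00]; move: p0; rewrite -p00 ltxx.
Qed.

Lemma ball_volume_gt0 m : (0 < ball_volume (m%:R : R))%R.
Proof.
have : (0 < Num.sqrt pi ^+ m :> R)%R by rewrite exprn_gt0// sqrtr_gt0 pi_gt0.
rewrite -lte_fin -ball_vol1_gamma => VI.
have := ball_vol_ge0 m (1 : R).
rewrite le_eqVlt => /predU1P[V0|]; first by rewrite -V0 mul0e ltxx in VI.
by rewrite ball_vol1E lte_fin pmulr_rgt0// exprn_gt0.
Qed.

(** A ball of diameter d has squared radius d^2 / 4; the right-hand side is the term of a set of
    diameter d in a Hausdorff sum. *)
Lemma ball_vol_diam m (d : R) : (0 <= d)%R ->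
  ball_vol m (d ^+ 2 / 4)%R = (ball_volume (m%:R : R) * d ^+ m)%:E.
Proof.
rewrite le_eqVlt => /predU1P[<-|d0]; last first.
  rewrite (_ : d ^+ 2 / 4 = (d / 2) ^+ 2 * 1)%R; last by field.
  rewrite ball_vol_scale ?divr_gt0// ball_vol1E -EFinM; congr EFin.
  rewrite expr_div_n; field.
  by rewrite lt0r_neq0// exprn_gt0.
rewrite expr0n/= mul0r; case: m => [|m].
  have := ball_vol1E 0; rewrite !expr0 mul1r mulr1 => <-.
  by rewrite /= ler01 lexx.
rewrite expr0n mulr0.
(* At t = 0, scaling by 2 gives V = 2^(m+1) V, and finiteness then forces V = 0. *)
have := ball_vol_scale m.+1 (0 : R) (ltr0n R 2); rewrite mulr0.
have : ball_vol m.+1 (0 : R) \is a fin_num.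
  rewrite ge0_fin_numE ?ball_vol_ge0//.
  by rewrite (le_lt_trans (ball_vol_nondecreasing _ ler01))// ball_vol1E ltry.
move: (ball_vol m.+1 0) => [V| |]// _ [] VE; congr EFin.
have : (0 < 2 ^+ m.+1 - 1 :> R)%R by rewrite subr_gt0 exprn_egt1// ltr1n.
by move=> ?; nra.
Qed.

End ball_volume_formula.

(** * The isodiametric inequality *)

Section isodiametric_step.
Variable R : realType.
Notation mu := (@lebesgue_measure R).
Local Open Scope ereal_scope.

(** [A] lies in [sup B - r, inf B + r] and [B] in [inf B, sup B]; these lengths add up to 2r. *)
Lemma lebesgue_measureD_le (A B : set R) (r : R) :
  measurable A -> measurable B -> A !=set0 -> B !=set0 ->
  (forall a b, A a -> B b -> (`|a - b| <= r)%R) ->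
  mu A + mu B <= (2 * r)%:E.
Proof.
move=> mA mB [a Aa] [b Bb] AB.
have supB : has_sup B.
  split; first by exists b.
  by exists (a + r)%R => x /(AB _ _ Aa); rewrite ler_norml; lra.
have infB : has_inf B.
  split; first by exists b.
  by exists (a - r)%R => x /(AB _ _ Aa); rewrite ler_norml; lra.
have Ale : A `<=` `[(sup B - r)%R, (inf B + r)%R]%classic.
  move=> x Ax /=; rewrite in_itv/=; apply/andP; split.
    rewrite lerBlDr; apply: ge_sup; first by exists b.
    by move=> y /(AB _ _ Ax); rewrite ler_norml; lra.
  rewrite -lerBlDr; apply: lb_le_inf; first by exists b.
  by move=> y /(AB _ _ Ax); rewrite ler_norml; lra.
have Ble : B `<=` `[inf B, sup B]%classic.
  move=> x Bx /=; rewrite in_itv/=; apply/andP; split.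
    exact: ge_inf infB.2 _ Bx.
  exact: ub_le_sup supB.2 _ Bx.
have /= := Ale _ Aa; rewrite in_itv/= => /andP[la ra].
have /= := Ble _ Bb; rewrite in_itv/= => /andP[lb rb].
apply: (@le_trans _ _ (mu `[(sup B - r)%R, (inf B + r)%R]%classic +
                      mu `[inf B, sup B]%classic)).
  by apply: leeD; apply: le_measure; rewrite ?inE//.
rewrite !lebesgue_measure_itv/= !lte_fin.
case: ifP => _; case: ifP => _; rewrite -?EFinB -?EFinD ?adde0 ?add0e lee_fin;
  lra.
Qed.

Lemma lebesgue_measure_centered (L : \bar R) : 0 <= L ->
  mu [set y : R | (2 * `|y|)%:E < L] = L.
Proof.
case: L => [r| |]//.
  rewrite lee_fin => r0; under eq_set do rewrite lte_fin.
  have -> : [set y : R | 2 * `|y| < r]%R = `](- (r / 2))%R, (r / 2)%R[%classic.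
    apply/seteqP; split => y /=; rewrite in_itv/= => h.
      have : (`|y| < r / 2)%R by lra.
      by rewrite ltr_norml.
    have : (`|y| < r / 2)%R by rewrite ltr_norml.
    lra.
  rewrite lebesgue_measure_itv/= lte_fin; case: ifPn => [_|].
    by rewrite -EFinD; congr EFin; lra.
  by rewrite -leNgt => r0'; congr EFin; lra.
move=> _; have -> : [set y : R | (2 * `|y|)%:E < +oo] = `]-oo, +oo[%classic.
  by apply/seteqP; split => y //= _; rewrite ltry.
by rewrite lebesgue_measure_itv.
Qed.

Variables (d : measure_display) (T : measurableType d).
Variable m : {sigma_finite_measure set T -> \bar R}.
(** [D] stands for the squared distance and [V c] for the volume of the ball of squared radius c,
    whose squared diameter is 4c. *)
Variables (D : T -> T -> R) (V : R -> \bar R).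
Hypothesis V_ge0 : forall t, 0 <= V t.
Hypothesis measurable_V : measurable_fun setT V.
Hypothesis isodiametric : forall (S : set T) (c : R), measurable S ->
  (forall x y, S x -> S y -> D x y <= 4 * c)%R -> m S <= V c.

(* Steiner symmetrization in the last coordinate: the section of S over x is
   replaced by the centered interval of the same length, which makes every
   slice y = const a set of smaller diameter. *)
Lemma isodiametric_prod (S : set (T * measurableTypeR R)) (c : R) :
  measurable S ->
  (forall x y, S x -> S y -> D x.1 y.1 + (x.2 - y.2) ^+ 2 <= 4 * c)%R ->
  (m \x mu) S <= \int[mu]_y V (c - y ^+ 2)%R.
Proof.
move=> mS SD.
pose ell (x : T) := mu (xsection S x).
have mell : measurable_fun setT ell by exact: measurable_fun_xsection.
pose W : set (T * measurableTypeR R) := [set z | (2 * `|z.2|)%:E < ell z.1].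
have mW : measurable W.
  rewrite -[W]setTI; apply: emeasurable_fun_lt => //.
    apply/measurable_EFinP; apply: measurable_funM => //.
    exact: measurableT_comp.
  exact: measurableT_comp.
have -> : (m \x mu) S = (m \x mu) W.
  apply: eq_integral => x _ /=; rewrite -[LHS]lebesgue_measure_centered//.
  congr (mu _); apply/seteqP; split => y /=.
    by move=> h; apply/mem_set.
  by move/set_mem.
(* The symmetrized set is now measured by its slices y = const, to which the lower-dimensional
   inequality applies. *)
rewrite (@product_measure_unique _ _ _ _ _ m mu (m \x^ mu))//; last first.
  by move=> A B mA mB; exact: product_measure2E.
apply: ge0_le_integral => //=.
- exact: measurable_fun_ysection.
- apply: (measurableT_comp measurable_V).
  by apply: measurable_funB => //; exact: measurable_funX.
move=> y _; apply: isodiametric; first exact: measurable_ysection.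
move=> x x' /set_mem Wx /set_mem Wx'.
(* Both sections are longer than 2|y|, so their lengths add up to more than 4|y| and some two of
   their points are more than 2|y| apart. This leaves at most 4c - 4y^2 for [D x x']. *)
have [a [b [Sa Sb ab]]] :
    exists a b, [/\ S (x, a), S (x', b) & (2 * `|y| < `|a - b|)%R].
  apply: contrapT => nab.
  have nonempty z : W (z, y) -> xsection S z !=set0.
    move=> Wz; apply/set0P; apply: contraTneq (Wz) => S0.
    by rewrite /W/= /ell S0 measure0 -leNgt lee_fin mulr_ge0.
  have ab_le a b : xsection S x a -> xsection S x' b ->
      (`|a - b| <= 2 * `|y|)%R.
    move=> /set_mem Sa /set_mem Sb; rewrite leNgt; apply/negP => ab.
    by apply: nab; exists a, b.
  have := lebesgue_measureD_le (measurable_xsection _ mS)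
    (measurable_xsection _ mS) (nonempty _ Wx) (nonempty _ Wx') ab_le.
  rewrite leNgt => /negP; apply.
  apply: le_lt_trans (lteD Wx Wx').
  by rewrite -EFinD lee_fin; lra.
have := SD _ _ Sa Sb => /=.
have : ((2 * `|y|) ^+ 2 <= `|a - b| ^+ 2)%R.
  by rewrite ler_sqr ?nnegrE ?mulr_ge0// ltW.
rewrite exprMn !real_normK ?num_real//; lra.
Qed.

End isodiametric_step.

(** * Euclidean spaces as iterated products *)

Section product_sigma_finite.
Context d1 d2 (T1 : measurableType d1) (T2 : measurableType d2) (R : realType).
Variable m1 : {sigma_finite_measure set T1 -> \bar R}.
Variable m2 : {sigma_finite_measure set T2 -> \bar R}.

Lemma product_measure_sigma_finite : sigma_finite setT (m1 \x m2)%E.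
Proof.
have /sigma_finiteP[F [TF ndF Foo]] := sigma_finiteT m1.
have /sigma_finiteP[G [TG ndG Goo]] := sigma_finiteT m2.
exists (fun n => F n `*` G n) => [|n].
  apply/seteqP; split => // -[x y] _.
  have [i _ Fx] : (\bigcup_i F i) x by rewrite -TF.
  have [j _ Gy] : (\bigcup_i G i) y by rewrite -TG.
  exists (maxn i j) => //; split.
    by move: x Fx; exact/subsetPset/ndF/leq_maxl.
  by move: y Gy; exact/subsetPset/ndG/leq_maxr.
have [mF Fn] := Foo n; have [mG Gn] := Goo n.
split; first exact: measurableX.
by rewrite product_measure1E// lte_mul_pinfty// ge0_fin_numE.
Qed.

(* HB does not infer this structure on [m1 \x m2] itself. *)
Definition sigma_finite_product :
    {sigma_finite_measure set (T1 * T2)%type -> \bar R} :=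
  HB.pack (m1 \x m2)%E (Measure_isSigmaFinite.Build _ _ _ (m1 \x m2)%E
    product_measure_sigma_finite).

End product_sigma_finite.

(** The display, the type and the measure all change with the dimension; bundling them permits the
    recursion on the dimension. *)
Record sfspace (R : realType) := SFSpace {
  sf_disp : measure_display;
  sf_type : measurableType sf_disp;
  sf_measure : {sigma_finite_measure set sf_type -> \bar R} }.

Fixpoint euclid (R : realType) (m : nat) : sfspace R :=
  if m is m'.+1 then
    SFSpace
      (sigma_finite_product (sf_measure (euclid R m')) (@lebesgue_measure R))
  else SFSpace (\d_tt : {sigma_finite_measure set unit -> \bar R}).

Section euclid_theory.
Variable R : realType.
Notation mu := (@lebesgue_measure R).
Notation E := (fun m => sf_type (euclid R m)).
Notation vol m := (sf_measure (euclid R m)).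

Fixpoint coord (m : nat) : E m -> nat -> R :=
  if m is m'.+1 then fun z k => if k == m' then z.2 else coord z.1 k
  else fun _ _ => 0.

Lemma measurable_coord m k : measurable_fun setT (fun z : E m => coord z k).
Proof.
elim: m => [|m IH] /=; first exact: measurable_cst.
case: eqP => _; first exact: measurable_snd.
exact: measurableT_comp IH measurable_fst.
Qed.

Definition sqdist m (x y : E m) : R :=
  \sum_(k < m) (coord x k - coord y k) ^+ 2.

Lemma sqdistS m (x y : E m.+1) :
  sqdist x y = sqdist x.1 y.1 + (x.2 - y.2) ^+ 2.
Proof.
rewrite /sqdist big_ord_recr/= eqxx; congr (_ + _); apply: eq_bigr => i _.
by rewrite ltn_eqF.
Qed.

Lemma isodiametric_measurable m (S : set (E m)) (c : R) : measurable S ->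
  (forall x y, S x -> S y -> sqdist x y <= 4 * c) ->
  (vol m S <= ball_vol m c)%E.
Proof.
elim: m S c => [|m IH] S c mS Sc.
  rewrite /= diracE; case: (boolP (tt \in S)) => [/set_mem Stt|_].
    have := Sc _ _ Stt Stt; rewrite /sqdist big_ord0 pmulr_rge0// => ->.
    exact: lexx.
  by rewrite lee_fin.
apply: (@isodiametric_prod _ _ _ (vol m) (@sqdist m) (@ball_vol R m)) => //.
- exact: measurable_ball_vol.
- by move=> x y Sx Sy; rewrite -sqdistS; exact: Sc.
Qed.

Let cell m (e : R) (z : E m) : {ffun 'I_m -> int} :=
  [ffun i : 'I_m => Num.floor (coord z i / e)].

Let cell_close m (e : R) (x u : E m) (i : 'I_m) : 0 < e ->
  cell e x = cell e u -> `|coord x i - coord u i| <= e.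
Proof.
move=> e0 /ffunP/(_ i); rewrite !ffunE => xu.
have := ge_floor (coord x i / e); have := lt_succ_floor (coord x i / e).
have := ge_floor (coord u i / e); have := lt_succ_floor (coord u i / e).
rewrite {}xu intrD; move: (_%:~R) => f.
rewrite !ler_pdivlMr// !ltr_pdivrMr// ler_norml => *; apply/andP; split; lra.
Qed.

(** For e > 0 this is the union of the grid cubes of side e that meet [S]: a countable union of
    boxes, whatever [S] is. *)
Let measurable_cell_hull m (e : R) (S : set (E m)) :
  measurable [set z | exists2 u, S u & cell e z = cell e u].
Proof.
rewrite (_ : [set _ | _] = \bigcup_(f in [set: {ffun 'I_m -> int}])
  (if `[< exists2 u, S u & cell e u = f >] then [set z | cell e z = f]
   else set0)).
  apply: countable_bigcupT_measurable => // f; case: ifP => // _.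
  rewrite (_ : [set _ | _] = \bigcap_(i in [set: 'I_m])
      (fun z : E m => coord z i / e) @^-1` [set x | Num.floor x = f i]).
    apply: fin_bigcap_measurable => [|i _]; first exact: finite_finset.
    rewrite (_ : [set x | _] = `[(f i)%:~R, (f i + 1)%:~R[%classic).
      rewrite -[X in measurable X]setTI.
      by apply: measurable_funM => //; exact: measurable_coord.
    apply/seteqP; split => x /=; rewrite in_itv/= -floor_eq; last by move/eqP.
    by move=> ->.
  apply/seteqP; split => z /=.
    by move=> <- i _ /=; rewrite ffunE.
  by move=> h; apply/ffunP => i; rewrite ffunE; exact: h.
apply/seteqP; split => z /=.
  move=> [u Su zu]; exists (cell e z) => //; case: ifPn => //= /asboolPn[].
  by exists u.
move=> [f _]; case: ifPn => // /asboolP[u Su <-] /= zu.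
by exists u.
Qed.

(** The hull is the intersection, over the grids of mesh 1/(k+1), of the unions of the cubes meeting
    [S]. Its points are limits of points of [S], so the diameter bound persists. *)
Lemma measurable_hull m (S : set (E m)) (c : R) :
  (forall x y, S x -> S y -> sqdist x y <= c) ->
  exists S', [/\ measurable S', S `<=` S' &
    forall x y, S' x -> S' y -> sqdist x y <= c].
Proof.
move=> Sc; exists (\bigcap_k
  [set z | exists2 u, S u & cell k.+1%:R^-1 z = cell k.+1%:R^-1 u]); split.
- by apply: bigcapT_measurable => k; exact: measurable_cell_hull.
- by move=> z Sz k _; exists z.
move=> x y S'x S'y; apply/ler_addgt0Pr => eps eps0.
(* Moving both points by at most e <= 1 in a coordinate changes a difference of size at most c + 1
   by at most 2e, hence its square by at most e (4 (c + 1) + 4). *)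
pose K : R := m%:R * (4 * (c + 1) + 4).
pose k := Num.truncn (K / eps).
have [u Su xu] := S'x k I; have [v Sv yv] := S'y k I.
have c0 : 0 <= c.
  by apply: le_trans (Sc _ _ Su Su); rewrite sumr_ge0// => i _; exact: sqr_ge0.
have Keps : K / k.+1%:R <= eps.
  rewrite ler_pdivrMr// mulrC -ler_pdivrMr// ltW//.
  by rewrite /k truncnS_gt.
apply: (@le_trans _ _ (sqdist u v + K / k.+1%:R)); last by rewrite lerD// Sc.
set e := k.+1%:R^-1 in xu yv *.
have e0 : 0 < e by rewrite invr_gt0.
have e1 : e <= 1 by rewrite invf_le1// ler1n.
rewrite (_ : K * e = \sum_(i < m) e * (4 * (c + 1) + 4)); last first.
  by rewrite sumr_const card_ord -mulr_natl /K; ring.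
rewrite -big_split/=; apply: ler_sum => i _.
have := cell_close i e0 xu; have := cell_close i e0 yv.
have uvc : (coord u i - coord v i) ^+ 2 <= c.
  apply: le_trans (Sc _ _ Su Sv); rewrite /sqdist (bigD1 i)//= lerDl.
  by rewrite sumr_ge0// => j _; exact: sqr_ge0.
move: (coord x i) (coord y i) (coord u i) (coord v i) uvc => a b p q pq.
rewrite !ler_norml => /andP[bq1 bq2] /andP[ap1 ap2].
have pq1 : -(c + 1) <= p - q <= c + 1.
  by apply/andP; split; nra.
nra.
Qed.

(** The sets of a Hausdorff cover are arbitrary, hence the bound is put on a measurable superset. *)
Theorem isodiametric m (S : set (E m)) (d : R) : 0 <= d ->
  (forall x y, S x -> S y -> sqdist x y <= d ^+ 2) ->
  exists S', [/\ measurable S', S `<=` S' &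
    (vol m S' <= (ball_volume (m%:R : R) * d ^+ m)%:E)%E].
Proof.
move=> d0 Sd; have [S' [mS' SS' S'd]] := measurable_hull Sd.
exists S'; split => //; rewrite -ball_vol_diam//.
apply: isodiametric_measurable => // x y S'x S'y.
by rewrite mulrC divfK// S'd.
Qed.

Lemma vol_box m (G : set R) : measurable G ->
  measurable [set z : E m | forall k, (k < m)%N -> G (coord z k)] /\
  vol m [set z | forall k, (k < m)%N -> G (coord z k)] = (mu G ^+ m)%E.
Proof.
move=> mG; elim: m => [|m [mB vB]] /=.
  rewrite (_ : [set _ | _] = setT); last by apply/seteqP; split.
  by split => //; rewrite diracT.
rewrite (_ : [set _ | _] =
    [set z | forall k, (k < m)%N -> G (coord z k)] `*` G); last first.
  apply/seteqP; split => z /=.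
    move=> zG; split => /=; last by have := zG m (ltnSn m); rewrite eqxx.
    by move=> k km; have := zG k (ltnW km); rewrite ltn_eqF.
  move=> [/= zG zm] k; rewrite ltnS leq_eqVlt.
  by case: eqVneq => //= _; exact: zG.
split; first exact: measurableX.
transitivity (vol m [set z | forall k, (k < m)%N -> G (coord z k)] * mu G)%E.
  exact: product_measure1E.
by rewrite vB muleC; exact/esym/expeS.
Qed.

End euclid_theory.

(** * Hausdorff measure *)

Section diameter.
Variables (R : realType) (n : nat).
Implicit Types (U A : set 'rV[R]_n) (x y : 'rV[R]_n).

Lemma euclid_normZ (a : R) x : euclid_norm (a *: x) = `|a| * euclid_norm x.
Proof.
rewrite /euclid_norm; under eq_bigr do rewrite mxE exprMn.
by rewrite -mulr_sumr sqrtrM ?sqr_ge0// sqrtr_sqr.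
Qed.

Lemma euclid_norm_le x (r : R) : 0 <= r -> (forall i, `|x ord0 i| <= r) ->
  euclid_norm x <= n%:R * r.
Proof.
move=> r0 xr; rewrite -[leRHS]ger0_norm ?mulr_ge0// -sqrtr_sqr ler_wsqrtr//.
apply: (@le_trans _ _ (\sum_(i < n) r ^+ 2)).
  by apply: ler_sum => i _; rewrite -real_normK ?num_real// lerXn2r ?nnegrE.
rewrite sumr_const card_ord -(mulr_natl (r ^+ 2)) exprMn ler_wpM2r ?sqr_ge0//.
by rewrite -natrX ler_nat; case: n => // k; rewrite expnS leq_pmulr// expn_gt0.
Qed.

Lemma diam_ge0 U : (0 <= diam U)%E.
Proof. by rewrite /diam le_max lexx. Qed.

Lemma diam_leP U (r : \bar R) : (0 <= r)%E ->
  (forall x y, U x -> U y -> ((euclid_norm (x - y))%:E <= r)%E) <->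
  (diam U <= r)%E.
Proof.
move=> r0; rewrite /diam ge_max r0/=; split=> [Ur|Ur x y Ux Uy].
  by apply: ge_ereal_sup => _ [[x y] [/= Ux Uy] <-]; exact: Ur.
by apply: le_trans Ur; apply: ereal_sup_ubound; exists (x, y).
Qed.

Lemma diamZ_le U (a : R) : 0 < a -> (diam ( *:%R a @` U) <= a%:E * diam U)%E.
Proof.
move=> a0; apply/diam_leP; first by rewrite mule_ge0 ?diam_ge0// lee_fin ltW.
move=> _ _ [x Ux <-] [y Uy <-]; rewrite -scalerBr euclid_normZ gtr0_norm// EFinM.
by rewrite lee_pmul2l//; exact: (diam_leP U (diam_ge0 U)).2.
Qed.

Lemma diam_pow_ge0 s U : (0 <= diam_pow s U)%E.
Proof. by rewrite /diam_pow; case: ifP => // _; exact: poweR_ge0. Qed.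

Lemma diam_powZ_le m U (a : R) : 0 < a ->
  (diam_pow m%:R ( *:%R a @` U) <= (a ^+ m)%:E * diam_pow m%:R U)%E.
Proof.
move=> a0; rewrite /diam_pow; have [->|U0] := eqVneq U set0.
  by rewrite image_set0 eqxx mule0.
have -> : ( *:%R a @` U == set0) = false.
  by apply/negbTE/set0P; have /set0P[x Ux] := U0; exists (a *: x), x.
rewrite -(powR_mulrn m (ltW a0)) -poweR_EFin -poweRM ?diam_ge0 ?lee_fin ?(ltW a0)//.
apply: gt0_ler_poweR; rewrite ?in_itv/= ?leey ?andbT ?diam_ge0//.
  by rewrite mule_ge0 ?diam_ge0// lee_fin ltW.
exact: diamZ_le.
Qed.

Lemma diam_pow_le m U (r : R) : 0 <= r -> (diam U <= r%:E)%E ->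
  (diam_pow m%:R U <= (r ^+ m)%:E)%E.
Proof.
move=> r0 Ur; rewrite /diam_pow; case: ifP => _.
  by rewrite lee_fin exprn_ge0.
rewrite -(powR_mulrn m r0) -poweR_EFin; apply: gt0_ler_poweR => //.
  by rewrite in_itv/= diam_ge0 leey.
by rewrite in_itv/= lee_fin r0 leey.
Qed.

Lemma diam_powE m U : U !=set0 -> diam U \is a fin_num ->
  diam_pow m%:R U = (fine (diam U) ^+ m)%:E.
Proof.
move=> /set0P/negbTE U0 Ufin; rewrite /diam_pow U0.
by rewrite -[in LHS](fineK Ufin) poweR_EFin powR_mulrn// fine_ge0 ?diam_ge0.
Qed.

End diameter.

Section hausdorff_theory.
Variables (R : realType) (n m : nat).
Implicit Types (A : set 'rV[R]_n) (delta : R).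
Local Open Scope ereal_scope.

Lemma hausdorff_content_le A delta U (M : \bar R) : delta_cover delta A U ->
  \sum_(0 <= i <oo) diam_pow m%:R (U i) <= M ->
  hausdorff_content m%:R delta A <= (ball_volume m%:R)%:E * M.
Proof.
move=> AU UM; apply: lee_wpmul2l.
  by rewrite lee_fin ltW// ball_volume_gt0.
by apply: le_trans UM; apply: ereal_inf_lbound; exists U.
Qed.

Lemma le_hausdorff_content A delta (M : \bar R) :
  (forall U, delta_cover delta A U ->
     M <= (ball_volume m%:R)%:E * \sum_(0 <= i <oo) diam_pow m%:R (U i)) ->
  M <= hausdorff_content m%:R delta A.
Proof.
have b0 := ball_volume_gt0 R m.
move=> MU; rewrite /hausdorff_content -lee_pdivrMl//.
by apply: le_ereal_inf_tmp => _ [U AU <-]; rewrite lee_pdivrMl//; exact: MU.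
Qed.

(** A smaller delta admits fewer covers, so the content is nonincreasing in delta and its limit at 0
    is a supremum. *)
Lemma hausdorff_measureE A : hausdorff_measure m%:R A =
  ereal_sup [set hausdorff_content m%:R delta A | delta in `]0%R, +oo[%classic].
Proof.
apply/cvg_lim => //; apply: (@nonincreasing_at_right_cvge _ _ _ +oo%O) => //.
move=> d e _ _ de; apply: le_hausdorff_content => U [AU Ud].
apply: hausdorff_content_le => //; split => // i.
by rewrite (le_trans (Ud i))// lee_fin.
Qed.

Lemma hausdorff_measure_le A (M : \bar R) :
  (forall delta, (0 < delta)%R -> hausdorff_content m%:R delta A <= M) ->
  hausdorff_measure m%:R A <= M.
Proof.
move=> AM; rewrite hausdorff_measureE; apply: ge_ereal_sup => _ [delta + <-].
by rewrite /= in_itv/= andbT => /AM.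
Qed.

Lemma le_hausdorff_measure A delta : (0 < delta)%R ->
  hausdorff_content m%:R delta A <= hausdorff_measure m%:R A.
Proof.
move=> d0; rewrite hausdorff_measureE; apply: ereal_sup_ubound.
by exists delta => //=; rewrite in_itv/= andbT.
Qed.

Lemma hausdorff_measureZ_le A (a : R) : (0 < a)%R ->
  hausdorff_measure m%:R ( *:%R a @` A) <= (a ^+ m)%:E * hausdorff_measure m%:R A.
Proof.
move=> a0; have am0 : (0 < a ^+ m)%R by rewrite exprn_gt0.
apply: hausdorff_measure_le => delta d0.
apply: (@le_trans _ _ ((a ^+ m)%:E * hausdorff_content m%:R (delta / a) A));
  last by rewrite lee_pmul2l// le_hausdorff_measure// divr_gt0.
rewrite -lee_pdivrMl//; apply: le_hausdorff_content => U [AU Ud].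
rewrite lee_pdivrMl// muleCA.
apply: (@hausdorff_content_le _ _ (fun i => *:%R a @` U i)).
  split=> [_ [x /AU[i _ Ux] <-]|i]; first by exists i => //; exists x.
  apply: le_trans (diamZ_le _ a0) _.
  by rewrite -lee_pdivlMl// muleC -EFinM.
rewrite -nneseriesZl//; last by move=> i _; exact: diam_pow_ge0.
by apply: lee_nneseries => i _; [move=> _; exact: diam_pow_ge0|exact: diam_powZ_le].
Qed.

Lemma hausdorff_measureZ A (a : R) : (0 < a)%R ->
  hausdorff_measure m%:R ( *:%R a @` A) = (a ^+ m)%:E * hausdorff_measure m%:R A.
Proof.
move=> a0; apply/eqP; rewrite eq_le hausdorff_measureZ_le//=.
(* The reverse inequality is the same bound for the inverse factor, applied to the scaled set. *)
have := @hausdorff_measureZ_le ( *:%R a @` A) a^-1; rewrite invr_gt0 => /(_ a0).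
rewrite image_comp (_ : _ \o _ = id); last first.
  by apply/funext => x /=; rewrite scalerA mulVf ?scale1r// lt0r_neq0.
by rewrite image_id exprVn lee_pdivlMl// exprn_gt0.
Qed.

End hausdorff_theory.

(** * Finiteness of the measure of antichains in the cube *)

Section antichain_upper_bound.
Variables (R : realType) (m : nat) (A : set 'rV[R]_m.+1).
Hypotheses (A_cube : A `<=` unit_cube R m.+1) (A_antichain : antichain A).

Lemma antichain_close (x y : 'rV[R]_m.+1) (e : R) : 0 <= e -> A x -> A y ->
  (forall i : 'I_m, `|(x ord0 (lift ord_max i) - x ord0 ord_max) -
                      (y ord0 (lift ord_max i) - y ord0 ord_max)| <= e) ->
  forall i, `|x ord0 i - y ord0 i| <= 2 * e.
Proof.
(* If the last coordinate of [v] exceeded that of [u] by more than [e], every other coordinate of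
   [v] would exceed that of [u] too, contradicting the antichain property. *)
have last_le u v : 0 <= e -> A u -> A v ->
    (forall i : 'I_m, `|(u ord0 (lift ord_max i) - u ord0 ord_max) -
                        (v ord0 (lift ord_max i) - v ord0 ord_max)| <= e) ->
    v ord0 ord_max - u ord0 ord_max <= e.
  move=> e0 Au Av uv; rewrite leNgt; apply/negP => euv.
  apply: (A_antichain Au Av).
    by move=> uvE; move: euv; rewrite uvE; lra.
  move=> i; case: (unliftP ord_max i) => [j|] ->; last lra.
  by have := uv j; rewrite ler_norml; lra.
move=> e0 Ax Ay xy.
have yx i : `|(y ord0 (lift ord_max i) - y ord0 ord_max) -
              (x ord0 (lift ord_max i) - x ord0 ord_max)| <= e.
  by rewrite distrC xy.
have := last_le _ _ e0 Ax Ay xy; have := last_le _ _ e0 Ay Ax yx => h1 h2 i.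
rewrite ler_norml; case: (unliftP ord_max i) => [j|] ->; last lra.
by have := xy j; rewrite ler_norml; lra.
Qed.

(* On an antichain the differences x_i - x_n determine x in a Lipschitz way, so
   a grid on [-1, 1]^m yields efficient covers. *)
Lemma hausdorff_antichain_le :
  (hausdorff_measure m%:R A <= (ball_volume m%:R * (6 * m.+1%:R) ^+ m)%:E)%E.
Proof.
apply: hausdorff_measure_le => delta d0.
(* Differences within 1/N give coordinates within 2/N by [antichain_close], hence a diameter of at
   most 2(m+1)/N. *)
have [N N0 rd] : exists2 N, 0 < N%:R :> R & m.+1%:R * (2 * N%:R^-1) <= delta.
  exists (Num.truncn (2 * m.+1%:R / delta)).+1; rewrite ?ltr0n//.
  have := truncnS_gt (2 * m.+1%:R / delta).
  by rewrite mulrA ler_pdivrMr ?ltr0n// ltr_pdivrMr//; lra.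
pose r : R := m.+1%:R * (2 * N%:R^-1).
have r0 : 0 <= r by rewrite mulr_ge0// mulr_ge0// invr_ge0 ltW.
(* The difference in [-1, 1] is rescaled to [0, 2N], so that its integer part is the grid index. *)
pose val (x : 'rV[R]_m.+1) (i : 'I_m) : R :=
  N%:R * (x ord0 (lift ord_max i) - x ord0 ord_max + 1).
have val_ge0 x i : A x -> 0 <= val x i <= (2 * N)%:R.
  move=> /A_cube Ax; have /andP[a0 a1] := Ax (lift ord_max i).
  have /andP[b0 b1] := Ax ord_max.
  rewrite natrM mulrC /val mulr_ge0 ?ler_wpM2l//; lra.
pose T := {ffun 'I_m -> 'I_(2 * N).+1}.
pose piece (f : T) := [set x | A x /\ forall i, Num.truncn (val x i) = f i].
(* The finitely many pieces are padded with empty sets, which contribute 0 even when m = 0. *)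
pose U i := if insub i is Some j then piece (enum_val (j : 'I_#|T|)) else set0.
have U_diam i : (diam (U i) <= r%:E)%E.
  rewrite /U; case: insubP => [j _ _|_]; apply/diam_leP => //.
  move=> x y [Ax xf] [Ay yf]; rewrite lee_fin; apply: euclid_norm_le.
    by rewrite mulr_ge0// invr_ge0 ltW.
  move=> k; rewrite !mxE; apply: antichain_close => //.
  move=> l; rewrite -(ler_pM2l N0) divff ?lt0r_neq0// -{1}(gtr0_norm N0) -normrM.
  have /andP[vx _] := val_ge0 x l Ax; have /andP[vy _] := val_ge0 y l Ay.
  have := truncn_itv vx; have := truncn_itv vy.
  rewrite xf yf -!natr1 ler_norml /val => /andP[? ?] /andP[? ?].
  by apply/andP; split; lra.
have AU : delta_cover delta A U.
  split=> [x Ax|i]; last by rewrite (le_trans (U_diam i))// lee_fin.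
  pose f : T := [ffun i => inord (Num.truncn (val x i))].
  exists (enum_rank f) => //; rewrite /U; case: insubP => [j _ jf|]; last first.
    by rewrite ltn_ord.
  have -> : enum_val j = f.
    by rewrite -[RHS]enum_rankK; congr enum_val; apply: val_inj.
  split=> // i; rewrite ffunE inordK// ltnS.
  have /andP[v0 v1] := val_ge0 x i Ax.
  by rewrite -(ler_nat R) (le_trans _ v1)//; have /andP[] := truncn_itv v0.
rewrite EFinM; apply: (hausdorff_content_le AU).
(* There are (2N+1)^m pieces, 2N + 1 <= 3N, and 3N r = 6(m+1) does not depend on N. *)
have T_r : #|T|%:R * r ^+ m <= (6 * m.+1%:R) ^+ m.
  rewrite card_ffun !card_ord natrX -exprMn lerXn2r ?nnegrE ?mulr_ge0//.
  apply: (@le_trans _ _ (3 * N%:R * r)).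
    rewrite ler_wpM2r// -natr1 natrM.
    have : (1 : R) <= N%:R by rewrite ler1n -(ltr0n R).
    lra.
  rewrite (_ : 3 * N%:R * r = 6 * m.+1%:R)// /r; field.
  exact: lt0r_neq0.
apply: (@le_trans _ _ (#|T|%:R * r ^+ m)%:E); last by rewrite lee_fin.
apply: lime_le; first by apply: is_cvg_nneseries => i _ _; exact: diam_pow_ge0.
apply: nearW => k.
have U_le i : (diam_pow m%:R (U i) <= ((i < #|T|)%N%:R * r ^+ m)%:E)%E.
  have [iT|iT] := ltnP i #|T|; first by rewrite mul1r diam_pow_le.
  by rewrite /U insubF ?ltnNge ?iT// /diam_pow eqxx mul0r.
apply: (@le_trans _ _ (\sum_(0 <= i < k) ((i < #|T|)%N%:R * r ^+ m)%:E)%E).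
  by apply: lee_sum => i _.
rewrite sumEFin lee_fin -mulr_suml ler_wpM2r ?exprn_ge0// -natr_sum ler_nat.
suff -> : (\sum_(0 <= i < k) (i < #|T|) = minn k #|T|)%N by exact: geq_minr.
elim: k => [|k IH]; first by rewrite big_nil min0n.
by rewrite big_nat_recr//= IH; lia.
Qed.

End antichain_upper_bound.

(** * Lower bound from separated pieces and their projections *)

Section separated_graphs.
Variables (R : realType) (m : nat) (A : set 'rV[R]_m.+1) (G : set R) (delta : R).
Hypotheses (delta_gt0 : 0 < delta) (mG : measurable G).
(** With [G] a set of numbers of k-th digit 0, these are the sets K_j after shrinking. *)
Let good (j : 'I_m.+1) (x : 'rV[R]_m.+1) :=
  A x /\ forall i, i != j -> G (x ord0 i).
Hypothesis good_full : forall (j : 'I_m.+1) (v : 'I_m -> R),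
  (forall k, G (v k)) -> exists2 x, A x & forall k, x ord0 (lift j k) = v k.
Hypothesis good_separated : forall (j l : 'I_m.+1) x y,
  good j x -> good l y -> j != l -> delta <= euclid_norm (x - y).
Notation mu := (@lebesgue_measure R).
Notation vol := (sf_measure (euclid R m)).

(** The projection along the j-th axis of the part of [U] in [good j], transported to the product
    space. *)
Let shadow (j : 'I_m.+1) (U : set 'rV[R]_m.+1) : set (sf_type (euclid R m)) :=
  [set e | exists2 x, (U `&` good j) x &
    forall k : 'I_m, coord e k = x ord0 (lift j k)].

(** Dropping a coordinate does not increase distances, so the isodiametric inequality applies with
    the diameter of [U]. The indicator records that a set missing [good j] has an empty shadow. *)
Let shadow_hull j U : (diam U < delta%:E)%E ->
  exists S, [/\ measurable S, shadow j U `<=` S &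
   (vol S <= `[< U `&` good j !=set0 >]%:R%:E *
             ((ball_volume m%:R)%:E * diam_pow m%:R U))%E].
Proof.
move=> Ud; case: asboolP => [[x [Ux jx]]|Uj]; last first.
  exists set0; split=> //; last by rewrite measure0 mul0e.
  by move=> e [x Ujx _]; apply: Uj; exists x.
have Ufin : diam U \is a fin_num.
  by rewrite ge0_fin_numE ?diam_ge0// (lt_trans Ud)// ltry.
have [||S [mS US vS]] := @isodiametric R m (shadow j U) (fine (diam U)).
- by rewrite fine_ge0// diam_ge0.
- move=> e f [y [Uy _] ey] [z [Uz _] fz].
  have : euclid_norm (y - z) <= fine (diam U).
    by rewrite -lee_fin fineK//; exact: (diam_leP U (diam_ge0 U)).2.
  rewrite -(@ler_sqr _ (euclid_norm _)) ?nnegrE ?sqrtr_ge0 ?fine_ge0 ?diam_ge0//.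
  rewrite sqr_sqrtr ?sumr_ge0// => [|i _]; last exact: sqr_ge0.
  apply: le_trans; rewrite (bigD1_ord j)//= /sqdist.
  rewrite -[leLHS]add0r lerD ?sqr_ge0//; apply: ler_sum => i _.
  by rewrite ey fz !mxE.
exists S; split=> //; rewrite mul1e diam_powE//; by exists x.
Qed.

(** For each [j] the shadows of a cover fill the box G^m, while a set of small diameter meets at
    most one [good j] and so is charged only once. *)
Lemma hausdorff_measure_ge :
  (m.+1%:R%:E * mu G ^+ m <= hausdorff_measure m%:R A)%E.
Proof.
(* The separation is only [delta <=]; halving keeps the diameters strictly below it. *)
have d2 : 0 < delta / 2 by rewrite divr_gt0.
apply: le_trans (le_hausdorff_measure m A d2).
apply: le_hausdorff_content => U [AU Ud].
have Ud' i : (diam (U i) < delta%:E)%E.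
  by apply: le_lt_trans (Ud i) _; rewrite lte_fin; lra.
pose w i := ((ball_volume m%:R)%:E * diam_pow m%:R (U i))%E.
have w0 i : (0 <= w i)%E.
  by rewrite mule_ge0 ?diam_pow_ge0// lee_fin ltW// ball_volume_gt0.
pose meets j i : bool := `[< U i `&` good j !=set0 >].
have shadow_le j : (mu G ^+ m <= \sum_(0 <= i <oo) (meets j i)%:R%:E * w i)%E.
  have /choice[S SP] : forall i, exists S, [/\ measurable S,
      shadow j (U i) `<=` S & (vol S <= (meets j i)%:R%:E * w i)%E].
    by move=> i; exact: shadow_hull.
  have [mB vB] := vol_box m mG.
  rewrite -vB; apply: (@le_trans _ _ (\sum_(0 <= i <oo) vol (S i))%E).
    apply: measure_sigma_subadditive => //; first by move=> i; have [] := SP i.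
    move=> e eG.
    (* Every point of the box is the projection of some point of [A], which the cover contains. *)
    have [k|x Ax xe] := @good_full j (fun k : 'I_m => coord e k).
      exact: eG.
    have [i _ Ux] := AU _ Ax; exists i => //; have [_ + _] := SP i; apply.
    exists x => //; split=> //; split=> // l lj.
    case: (unliftP j l) => [k ->|ljE]; last by rewrite ljE eqxx in lj.
    by rewrite xe; exact: eG.
  by apply: lee_nneseries => i _ //; have [] := SP i.
rewrite -nneseriesZl; last by move=> i _; exact: diam_pow_ge0.
apply: (@le_trans _ _
    (\sum_(j < m.+1) \sum_(0 <= i <oo) (meets j i)%:R%:E * w i)%E).
  rewrite (_ : _ * _ = \sum_(j < m.+1) mu G ^+ m)%E; last first.
    by rewrite sumr_const card_ord mule_natl.
  by apply: lee_sum => j _.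
(* Exchanging the sums weights [w i] by the number of [j] for which [U i] meets [good j]; separation
   bounds it by 1. *)
rewrite -nneseries_sum; last by move=> *; rewrite mule_ge0// lee_fin.
apply: lee_nneseries => i _.
  by move=> _; apply: sume_ge0 => j _; rewrite mule_ge0// lee_fin.
rewrite -ge0_sume_distrl; last by move=> j _; rewrite lee_fin.
rewrite -[leRHS]mul1e; apply: lee_wpmul2r => //.
rewrite sumEFin lee_fin -natr_sum -[leRHS]/(1%:R) ler_nat.
have [/existsP[j jU]|/existsPn noU] := boolP [exists j, meets j i]; last first.
  by rewrite big1// => j _; rewrite (negbTE (noU j)).
rewrite (bigD1 j)//= big1 ?addn0 ?leq_b1// => l lj.
apply/eqP; rewrite eqb0; apply/asboolPn => -[y [Uy ly]].
have /asboolP[x [Ux jx]] := jU.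
have := good_separated ly jx lj.
have : ((euclid_norm (y - x))%:E <= diam (U i))%E.
  exact: (diam_leP _ (diam_ge0 (U i))).2.
by move=> /le_trans/(_ (Ud i)); rewrite lee_fin; lra.
Qed.

End separated_graphs.

(** * Integer codings of the unit interval *)

Section coding.
Variable R : realType.
Notation mu := (@lebesgue_measure R).

(* The cell of index 0 has length 1 - 1/(k+2). As these factors tend to 1 their
   k-th digit is 0 on almost all of (0, 1), and as their product tends to 0 the
   digits determine the point. *)
Let half_gap (k : nat) : R := (2 * k.+2%:R)^-1.
Let tail (k j : nat) : R := half_gap k * 2^-1 ^+ j.

(** The left end of the cell of index [a]. The remaining distance to 0, respectively to 1, halves
    from one knot to the next, so the knots accumulate only at 0 and 1. *)
Definition knot (k : nat) (a : int) : R :=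
  match a with
  | Posz 0 => tail k 0
  | Posz j.+1 => 1 - tail k j
  | Negz j => tail k j.+1
  end.

Definition width k a : R := knot k (a + 1) - knot k a.

Let half_gap_gt0 k : 0 < half_gap k.
Proof. by rewrite invr_gt0 mulr_gt0. Qed.

Let half_gap_le k : half_gap k <= 1 / 4.
Proof.
rewrite mul1r lef_pV2 ?posrE ?mulr_gt0//.
have : (2 : R) <= k.+2%:R by rewrite ler_nat.
lra.
Qed.

Let tail_gt0 k j : 0 < tail k j.
Proof. by rewrite mulr_gt0// exprn_gt0. Qed.

Let tailS k j : tail k j.+1 = tail k j / 2.
Proof. by rewrite /tail exprSr mulrA. Qed.

Let tail_le k j : tail k j <= 1 / 4.
Proof.
elim: j => [|j IH]; first by rewrite /tail expr0 mulr1.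
by rewrite tailS; have := tail_gt0 k j; lra.
Qed.

Let PoszS j : Posz j + 1 = Posz j.+1. Proof. by rewrite addrC -intS. Qed.
Let NegzS j : Negz j.+1 + 1 = Negz j. Proof. by lia. Qed.

Lemma knot_gt0 k a : 0 < knot k a.
Proof.
case: a => [[|j]|j] /=; rewrite ?tail_gt0//.
by rewrite subr_gt0; have := tail_le k j; lra.
Qed.

Lemma knot_lt1 k a : knot k a < 1.
Proof.
case: a => [[|j]|j] /=.
- by have := tail_le k 0; lra.
- by have := tail_gt0 k j; lra.
- by have := tail_le k j.+1; lra.
Qed.

Lemma width0 k : width k 0 = 1 - k.+2%:R^-1.
Proof.
rewrite /width add0r /= /tail expr0 mulr1 /half_gap.
have : k.+2%:R != 0 :> R by rewrite pnatr_eq0.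
by move: (k.+2%:R) => t t0; field.
Qed.

Lemma width_gt0 k a : 0 < width k a.
Proof.
rewrite /width; case: a => [[|j]|[|j]].
- by rewrite add0r /=; have := tail_le k 0; lra.
- by rewrite PoszS /=; have := tailS k j; have := tail_gt0 k j; lra.
- rewrite (_ : Negz 0 + 1 = Posz 0)//=.
  by have := tailS k 0; have := tail_gt0 k 0; lra.
- by rewrite NegzS /=; have := tailS k j.+1; have := tail_gt0 k j.+1; lra.
Qed.

(** The cell of index 0 is the widest. These bounds telescope: their product over the levels below K
    is 1/(K+1). *)
Lemma width_le k a : width k a <= k.+1%:R / k.+2%:R.
Proof.
have -> : k.+1%:R / k.+2%:R = width k 0.
  have : k.+2%:R != 0 :> R by rewrite pnatr_eq0.
  rewrite width0 (_ : k.+1%:R = k.+2%:R - 1); last first.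
    by rewrite -[k.+2%:R]natr1 addrK.
  by move: (k.+2%:R) => t t0; field.
have w0 : 1 / 2 <= width k 0.
  by rewrite /width add0r /=; have := tail_le k 0; lra.
case: a => [[|j]|j] //; apply: le_trans w0; rewrite /width.
  by rewrite PoszS /=; have := tail_gt0 k j.+1; have := tail_le k j; lra.
case: j => [|j].
  rewrite (_ : Negz 0 + 1 = Posz 0)//=.
  by have := tail_gt0 k 1; have := tail_le k 0; lra.
by rewrite NegzS /=; have := tail_gt0 k j.+2; have := tail_le k j.+1; lra.
Qed.

Lemma knot_mono k (a b : int) : a < b -> knot k (a + 1) <= knot k b.
Proof.
move=> ab; have [d ->] : exists d : nat, b = a + 1 + d%:Z.
  by exists (absz (b - (a + 1))%R); lia.
elim: d => [|d IH]; first by rewrite addr0.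
apply: le_trans IH _; rewrite -addn1 PoszD addrA.
by have := width_gt0 k (a + 1 + d); rewrite /width; lra.
Qed.

Let tail_lt k (y : R) : 0 < y -> exists j, tail k j < y.
Proof.
move=> y0; exists (Num.truncn y^-1).
have := truncnS_gt y^-1; set j := Num.truncn _.
rewrite -(ltr_pM2l y0) divff ?lt0r_neq0// => yj.
rewrite -(@ltr_pM2r _ j.+1%:R)//; apply: le_lt_trans yj.
apply: (@le_trans _ _ (tail k j * 2 ^+ j)).
  by rewrite ler_pM2l// -natrX ler_nat ltn_expl.
rewrite /tail -mulrA -exprMn mulVf// expr1n mulr1.
by have := half_gap_le k; lra.
Qed.

Lemma knot_cover k (y : R) : 0 < y < 1 ->
  exists a, knot k a <= y < knot k (a + 1).
Proof.
move=> /andP[y0 y1]; have [yt|ty] := ltP y (tail k 0).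
  have ex : exists j, tail k j <= y by have [j /ltW] := tail_lt k y0; exists j.
  case: (ex_minnP ex) => -[|j] jy jmin; first by move: yt; rewrite ltNge jy.
  exists (Negz j); rewrite /= jy/=; have jy' : y < tail k j.
    by rewrite ltNge; apply/negP => /jmin; rewrite ltnn.
  by case: j jy' {jy jmin} => [|j]; rewrite ?NegzS.
have [yt|ty'] := ltP y (1 - tail k 0).
  by exists 0; rewrite /= ty.
have ex : exists j, y < 1 - tail k j.
  by have [|j] := @tail_lt k (1 - y); [lra|exists j; lra].
case: (ex_minnP ex) => -[|j] jy jmin; first by move: jy; rewrite ltNge ty'.
exists (Posz j.+1); rewrite PoszS /= jy andbT.
by rewrite leNgt; apply/negP => /jmin; rewrite ltnn.
Qed.

Definition branch k a (z : R) : R := knot k a + width k a * z.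

Lemma branch_bounds k a z : 0 < z < 1 ->
  knot k a < branch k a z < knot k (a + 1).
Proof.
have := width_gt0 k a; rewrite /branch /width => w0 /andP[z0 z1].
by apply/andP; split; nra.
Qed.

Lemma branch_homo k a y z : y < z -> branch k a y < branch k a z.
Proof. by move=> yz; rewrite ltrD2l ltr_pM2l// width_gt0. Qed.

(* [coded c x]: the digits of [x] are [c 0, c 1, ...]; [y k] is the position of
   [x], rescaled to (0, 1), in its cell of level [k]. *)
Definition coded (c : nat -> int) (x : R) := exists y : nat -> R,
  y 0%N = x /\ forall k, 0 < y k < 1 /\ y k = branch k (c k) (y k.+1).

Lemma coded_itv c x : coded c x -> 0 < x < 1.
Proof. by case=> y [<- /(_ 0%N)[]]. Qed.

(** At level [k] the rescaled points lie in different cells, in the right order; the common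
    increasing branches of the earlier levels carry this order back to level 0. *)
Lemma coded_lt c d x y k : coded c x -> coded d y ->
  (forall j, (j < k)%N -> c j = d j) -> c k < d k -> x < y.
Proof.
move=> [p [<- pP]] [q [<- qP]] cd ckdk.
suff : forall i, (i <= k)%N -> p (k - i)%N < q (k - i)%N.
  by move=> /(_ k (leqnn k)); rewrite subnn.
elim=> [_|i IH ik].
  rewrite subn0 (pP k).2 (qP k).2.
  have /andP[_ h1] := branch_bounds k (c k) (pP k.+1).1.
  have /andP[h2 _] := branch_bounds k (d k) (qP k.+1).1.
  exact: lt_trans (lt_le_trans h1 (knot_mono k ckdk)) h2.
have -> : (k - i.+1 = (k - i).-1)%N by lia.
have kiS : ((k - i).-1.+1 = k - i)%N by lia.
rewrite (pP (k - i).-1).2 (qP (k - i).-1).2 kiS cd; last by lia.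
by apply: branch_homo; apply: IH; lia.
Qed.

(** By [width_le], passing through [K] common levels stretches the distance by a factor of at least
    K + 1, yet it stays below 1. *)
Lemma coded_inj c x y : coded c x -> coded c y -> x = y.
Proof.
move=> [p [<- pP]] [q [<- qP]].
have contr K : `|p 0%N - q 0%N| * K.+1%:R <= `|p K - q K|.
  elim: K => [|K IH]; first by rewrite mulr1.
  have := IH; rewrite (pP K).2 (qP K).2 /branch.
  rewrite opprD addrACA subrr add0r -mulrBr.
  rewrite normrM gtr0_norm ?width_gt0// => h.
  have := le_trans h (ler_wpM2r (normr_ge0 _) (width_le K (c K))).
  by rewrite mulrAC ler_pdivlMr// mulrAC [leRHS]mulrC ler_pM2r.
apply/eqP; rewrite -subr_eq0 -normr_le0 leNgt; apply/negP => pq.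
have := contr (Num.truncn `|p 0%N - q 0%N|^-1).
have := truncnS_gt `|p 0%N - q 0%N|^-1.
set K := Num.truncn _; rewrite -(ltr_pM2l pq) divff ?lt0r_neq0// => h1 h2.
have := lt_le_trans h1 h2; have [/andP[p0 p1] _] := pP K.
by have [/andP[q0 q1] _] := qP K; rewrite ltr_normr; lra.
Qed.

(** For z = 0 this is the left end of the cell with digits [s], counted from level [l]; only
    countably many such points exist. *)
Fixpoint iter_branch (l : nat) (s : seq int) (z : R) : R :=
  if s is a :: s' then branch l a (iter_branch l.+1 s' z) else z.

Lemma iter_branch_orbit (c : nat -> int) (y : nat -> R) l k :
  (forall j, y j = branch j (c j) (y j.+1)) ->
  y l = iter_branch l (map c (iota l k)) (y (l + k)%N).
Proof.
by move=> yE; elim: k l => [|k IH] l /=; rewrite ?addn0// -addSnnS -IH.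
Qed.

Let iter_branch_itv l s : 0 <= iter_branch l s 0 < 1.
Proof.
elim: s l => [|a s IH] l /=; first by rewrite lexx ltr01.
have /andP[h0 h1] := IH l.+1; have w0 := width_gt0 l a.
have := knot_lt1 l (a + 1); have := knot_gt0 l a.
by rewrite /branch; move: w0; rewrite /width => *; apply/andP; split; nra.
Qed.

(** The point is the supremum of the left ends of the nested cells. It stays strictly inside (0, 1)
    because all knots do, so every integer sequence is a code. *)
Lemma coded_surj c : exists x, coded c x.
Proof.
pose S l := [set iter_branch l (map c (iota l K)) 0 | K in [set: nat]].
pose y l := sup (S l).
have S_ub l : ubound (S l) 1.
  by move=> _ [K _ <-]; have /andP[_ /ltW] := iter_branch_itv l (map c (iota l K)).
have S0 l : S l 0 by exists 0%N.
have y_ub l z : S l z -> z <= y l by apply: ub_le_sup; exists 1.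
have y01 l : 0 <= y l <= 1.
  rewrite y_ub//=; apply: ge_sup => //; first by exists 0.
have yE l : y l = branch l (c l) (y l.+1).
  have w0 := width_gt0 l (c l).
  apply/eqP; rewrite eq_le; apply/andP; split.
    apply: ge_sup; first by exists 0.
    move=> _ [[|K] _ <-] /=.
      have /andP[? _] := y01 l.+1; have := knot_gt0 l (c l).
      by rewrite /branch; nra.
    by rewrite lerD2l ler_pM2l//; apply: y_ub; exists K.
  rewrite /branch -lerBrDl mulrC -ler_pdivlMr//.
  apply: ge_sup; first by exists 0.
  move=> _ [K _ <-]; rewrite ler_pdivlMr// lerBrDl mulrC.
  by apply: y_ub; exists K.+1.
exists (y 0%N), y; split=> // l; split=> //.
rewrite yE; have /andP[h0 h1] := y01 l.+1.
have := width_gt0 l (c l); have := knot_lt1 l (c l + 1); have := knot_gt0 l (c l).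
by rewrite /branch /width => *; apply/andP; split; nra.
Qed.

(** Digits are read off level by level; this can only stop when a rescaled point equals 0, that is,
    when [x] is the left end of a cell. *)
Lemma coded_co_countable (x : R) :
  0 < x < 1 -> ~ range (fun s => iter_branch 0 s 0) x ->
  exists c, coded c x.
Proof.
move=> x01 xB.
have /choice[idx idxP] : forall p : nat * R, exists a, 0 < p.2 < 1 ->
    knot p.1 a <= p.2 < knot p.1 (a + 1).
  move=> [k y]; have [y01|y01] := boolP (0 < y < 1); last by exists 0.
  by have [a aP] := knot_cover k y01; exists a.
pose y := fix y k := if k is k'.+1 then
  (y k' - knot k' (idx (k', y k'))) / width k' (idx (k', y k')) else x.
pose c k := idx (k, y k).
have yE k : y k = branch k (c k) (y k.+1).
  by rewrite /branch /= mulrC divfK ?lt0r_neq0 ?width_gt0// subrKC.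
have y01 k : 0 < y k < 1.
  elim: k => // k IH.
  have := idxP (k, y k) IH; rewrite /= -/(c k) => /andP[ky yk].
  have w0 := width_gt0 k (c k).
  have ySk0 : y k.+1 != 0.
    apply/eqP => ySk0; apply: xB.
    exists (map c (iota 0 k.+1)) => //=.
    by have := iter_branch_orbit 0 k.+1 yE; rewrite add0n ySk0.
  rewrite lt_neqAle eq_sym ySk0 andTb.
  apply/andP; split; first by apply: divr_ge0; [rewrite subr_ge0|exact: ltW].
  by rewrite ltr_pdivrMr// mul1r ltrBlDl /width subrKC.
by exists c, y.
Qed.

End coding.

(** Around each point of [V] a ball of half the available radius works uniformly; compactness yields
    one radius for all of [V]. *)
Lemma compact_open_dist (R : realType) (V O : set R) :
  compact V -> open O -> V `<=` O ->
  exists2 delta, 0 < delta & forall x y, V x -> ~ O y -> delta <= `|x - y|.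
Proof.
move=> cV oO VO.
pose P (e x : R) := forall y, `|x - y| < e -> O y.
have : \forall e \near (0 : R)^'+, V `<=` P e.
  apply: ((compact_near_coveringP V).1 cV R _ P) => x Vx.
  have /nbhs_ballP[r /= r0 xrO] := open_nbhs_nbhs (conj oO (VO _ Vx)).
  exists (ball x (r / 2), [set e | e < r / 2]) => [|[x' e] /= [xx' er] y x'y].
    by split; [apply: nbhsx_ballx; lra|apply: nbhs_right_lt; lra].
  apply: xrO; move: xx'; rewrite /ball/= => xx'.
  have := ler_distD x' x y; lra.
move=> VO'; near (0 : R)^'+ => e.
have VPe : V `<=` P e by near: e.
exists e => // x y Vx Oy; rewrite leNgt; apply/negP => xye; apply: Oy.
exact: VPe Vx _ xye.
Unshelve. all: by end_near. Qed.

Local Arguments knot : simpl never.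

(** * The open set of points with k-th digit 0 *)

Section zero_digit.
Variable R : realType.
Notation mu := (@lebesgue_measure R).

(** Points of (0, 1), viewed as rescaled points of level [l], whose digit at level l + k is 0. The
    open interval in the base case makes the whole set open. *)
Fixpoint zero_digit (k l : nat) : set R :=
  if k is k'.+1 then
    [set x | exists a : int, zero_digit k' l.+1 ((x - knot R l a) / width R l a)]
  else `]knot R l 0, knot R l 1[%classic.

Lemma open_zero_digit k l : open (zero_digit k l).
Proof.
elim: k l => [|k IH] l /=; first exact: itv_open.
rewrite (_ : [set x | _] = \bigcup_(a in [set: int])
    (fun x => (x - knot R l a) / width R l a) @^-1` zero_digit k l.+1).
  apply: bigcup_open => a _; apply: open_comp => // x _.
  by apply: cvgM; [apply: cvgB; [exact: cvg_id|exact: cvg_cst]|exact: cvg_cst].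
by apply/seteqP; split => x /= [a]; [exists a|move=> _; exists a].
Qed.

Let branchK l a (x : R) :
  x = branch l a ((x - knot R l a) / width R l a).
Proof. by rewrite /branch mulrC divfK ?lt0r_neq0 ?width_gt0// subrKC. Qed.

Lemma zero_digit_itv k l x : zero_digit k l x -> 0 < x < 1.
Proof.
elim: k l x => [|k IH] l x /=.
  rewrite in_itv/= => /andP[lx xl].
  by rewrite (lt_trans (knot_gt0 _ _ _) lx) (lt_trans xl (knot_lt1 _ _ _)).
move=> [a /IH/(branch_bounds l a)]; rewrite -branchK => /andP[ax xa].
by rewrite (lt_trans (knot_gt0 _ _ _) ax) (lt_trans xa (knot_lt1 _ _ _)).
Qed.

Let knot_unique k (a b : int) (x : R) : knot R k a < x < knot R k (a + 1) ->
  knot R k b < x < knot R k (b + 1) -> a = b.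
Proof.
move=> /andP[ax xa] /andP[bx xb]; apply/eqP; rewrite eq_le !leNgt.
apply/andP; split; apply/negP => /(knot_mono R k) ab.
  by have := lt_trans (lt_le_trans xb ab) ax; rewrite ltxx.
by have := lt_trans (lt_le_trans xa ab) bx; rewrite ltxx.
Qed.

Lemma coded_zero_digit c (x : R) k : coded c x ->
  zero_digit k 0 x <-> c k = 0.
Proof.
move=> [y [<- yP]].
suff : forall l, zero_digit k l (y l) <-> c (l + k)%N = 0.
  by move=> /(_ 0%N); rewrite add0n.
have in_cell l : knot R l (c l) < y l < knot R l (c l + 1).
  by rewrite (yP l).2; exact: branch_bounds (yP l.+1).1.
have rescale l : (y l - knot R l (c l)) / width R l (c l) = y l.+1.
  by rewrite (yP l).2 /branch addrC addKr mulrC mulKf ?lt0r_neq0 ?width_gt0.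
elim: k => [|k IH] l /=.
  rewrite addn0 in_itv/=; split=> [cl|cl].
    by apply/esym; apply: knot_unique (in_cell l); rewrite add0r.
  by have := in_cell l; rewrite cl add0r.
rewrite -addSnnS -IH; split=> [[a aP]|yl].
  have := branch_bounds l a (zero_digit_itv aP).
  rewrite -branchK => /knot_unique/(_ (in_cell l)) acl.
  by move: aP; rewrite acl rescale.
by exists (c l); rewrite rescale.
Qed.

(** For k = 0 the two outer intervals have total length 1/(l+2). Otherwise each cell contains a
    scaled copy of the complement from the next level, and the widths add up to at most 1. *)
Lemma lebesgue_zero_digitC k l :
  (mu (`[0%R, 1%R[%classic `\` zero_digit k l) <= ((l + k).+2%:R^-1)%:E)%E.
Proof.
have mC k' l' : measurable (`[0, 1[%classic `\` zero_digit k' l').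
  by apply: measurableD => //; apply: open_measurable; exact: open_zero_digit.
elim: k l => [|k IH] l.
  rewrite addn0; apply: (@le_trans _ _
      (mu (`[0%R, knot R l 0]%classic `|` `[knot R l 1, 1%R]%classic))).
    apply: le_measure; rewrite ?inE//; first exact: mC.
      exact: measurableU.
    move=> x [] /=; rewrite !in_itv/= => /andP[x0 x1] /negP.
    by rewrite negb_and -!leNgt => /orP[xl|xl]; [left|right]; rewrite ?x0 ?xl ?ltW.
  apply: (@le_trans _ _
      (mu `[0%R, knot R l 0]%classic + mu `[knot R l 1, 1%R]%classic)%E).
    exact: measureU2.
  rewrite !lebesgue_measure_itv/= !lte_fin knot_gt0 knot_lt1.
  have : knot R l 1 - knot R l 0 = 1 - l.+2%:R^-1 by exact: width0.
  rewrite oppr0 addr0 -EFinD lee_fin.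
  by move: (knot R l 0) (knot R l 1) (l.+2%:R^-1) => u v w; lra.
pose N := `[0%R, 1%R[%classic `\` zero_digit k l.+1 : set R.
pose cell a := [set x | N ((x - knot R l a) / width R l a)].
have mcell a : measurable (cell a).
  rewrite -[cell a]setTI; have mN : measurable N by exact: mC.
  suff : measurable_fun setT (fun x : R => (x - knot R l a) / width R l a).
    exact.
  by apply: measurable_funM => //; exact: measurable_funB.
have mu_cell a : (mu (cell a) = (width R l a)%:E * mu N)%E.
  rewrite (lebesgue_measure_affine (knot R l a) (width_gt0 R l a))//.
  congr (_ * mu _)%E; apply/seteqP; split => x /=;
  by rewrite /cell/= addrC addKr mulrC mulKf ?lt0r_neq0 ?width_gt0.
(* The integers are enumerated in pairs j, -j-1; the point 0 is added because it lies in no cell. *)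
pose F j := [set 0%R] `|` (cell (Posz j) `|` cell (Negz j)).
have mF j : measurable (F j) by do 2 apply: measurableU => //.
apply: (@le_trans _ _ (\sum_(0 <= j <oo) mu (F j))%E).
  apply: measure_sigma_subadditive => //; first exact: mC.
  move=> x [/= + xz].
  rewrite in_itv/= le_eqVlt => /andP[/predU1P[<- _|x0 x1]].
    by exists 0%N => //; left.
  have [a /andP[ax xa]] := @knot_cover R l x (introT andP (conj x0 x1)).
  have xcell : cell a x.
    split; last by move=> xN; apply: xz; exists a.
    rewrite /= in_itv/= ltr_pdivrMr ?width_gt0// mul1r ltrBlDl /width subrKC xa andbT.
    by apply: divr_ge0; [rewrite subr_ge0|exact/ltW/width_gt0].
  by case: a {ax xa} xcell => j jx; exists j => //; right; [left|right].
have mu_F j : (mu (F j) <=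
    ((width R l (Posz j) + width R l (Negz j)) / (l + k.+1).+2%:R)%:E)%E.
  apply: (@le_trans _ _
      (mu [set 0%R] + (mu (cell (Posz j)) + mu (cell (Negz j))))%E).
    have : (mu (F j) <= mu [set 0%R] + mu (cell (Posz j) `|` cell (Negz j)))%E.
      by apply: measureU2; [|apply: measurableU; exact: mcell].
    by move=> /le_trans; apply; apply: leeD => //; apply: measureU2; exact: mcell.
  rewrite lebesgue_measure_set1 add0e.
  rewrite mulrDl EFinD.
  by apply: leeD; rewrite mu_cell EFinM lee_pmul2l ?lte_fin ?width_gt0//
    -addSnnS IH.
apply: lime_le; first exact: is_cvg_nneseries.
apply: nearW => n; apply: (le_trans (lee_sum _ (fun j _ => mu_F j))).
rewrite sumEFin lee_fin -mulr_suml -[leRHS]mul1r ler_wpM2r//.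
(* The cells of index -n to n-1 are adjacent, so their widths telescope. *)
rewrite (_ : \sum_(0 <= j < n) _ = knot R l (Posz n) - knot R l (- Posz n)).
  by have := knot_lt1 R l (Posz n); have := knot_gt0 R l (- Posz n); lra.
elim: n => [|n IHn]; first by rewrite big_nil oppr0 subrr.
rewrite big_nat_recr//= IHn /width.
have -> : Negz n + 1 = - Posz n by lia.
have -> : Posz n + 1 = Posz n.+1 by lia.
have -> : - Posz n.+1 = Negz n by [].
by lra.
Qed.

End zero_digit.

(** * The antichain *)

Section code_antichain.
Variables (R : realType) (m : nat).
Notation mu := (@lebesgue_measure R).

Definition code_antichain : set 'rV[R]_m.+1 :=
  [set x | exists c : 'I_m.+1 -> nat -> int,
    (forall i, coded (c i) (x ord0 i)) /\ forall k, \sum_i c i k = 1].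

Lemma code_antichain_cube : code_antichain `<=` unit_cube R m.+1.
Proof.
by move=> x [c [cx _]] i; have /andP[/ltW-> /ltW->] := coded_itv (cx i).
Qed.

(* At the first level where the codes differ the digits of both points have sum
   1, hence some coordinate has a larger digit in x than in y. *)
Lemma code_antichainP : antichain code_antichain.
Proof.
move=> x y [c [cx c1]] [d [dy d1]] xy xley.
have [cd|] := pselect (forall k i, c i k = d i k).
  apply: xy; apply/rowP => i; apply: coded_inj (cx i) _.
  by rewrite (_ : c i = d i)//; apply/funext => k.
move=> /existsNP ex; have exb : exists k, `[< ~ forall i, c i k = d i k >].
  by have [k kP] := ex; exists k; apply/asboolP.
case: (ex_minnP exb) => k /asboolP kP kmin.
have below i j : (j < k)%N -> c i j = d i j.
  move=> jk; apply: contrapT => cdij; have : (k <= j)%N.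
    by apply: kmin; apply/asboolP => /(_ i).
  by rewrite leqNgt jk.
have [i dc] : exists i, d i k < c i k.
  apply: contrapT => nlt; apply: kP => i.
  have cled l : c l k <= d l k.
    by rewrite leNgt; apply/negP => dlt; apply: nlt; exists l.
  have : \sum_l (d l k - c l k) = 0 by rewrite sumrB c1 d1 subrr.
  move/eqP; rewrite psumr_eq0; last by move=> l _; rewrite subr_ge0.
  by move=> /allP/(_ i (mem_index_enum _)); rewrite subr_eq0 => /eqP.
have := coded_lt (dy i) (cx i) (fun j jk => esym (below i j jk)) dc.
by rewrite ltNge xley.
Qed.

(** The j-th coordinate gets the digits that complete each sum to 1; [coded_surj] realizes them,
    whatever integers they are. *)
Lemma code_antichain_full c (j : 'I_m.+1) (v : 'I_m -> R) :
  (forall i, coded (c i) (v i)) ->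
  exists2 x, code_antichain x & forall i, x ord0 (lift j i) = v i.
Proof.
move=> cv; have [xj xjP] := coded_surj R (fun k => 1 - \sum_i c i k).
exists (\row_i oapp v xj (unlift j i)); last by move=> i; rewrite mxE liftK.
exists (fun i => oapp c (fun k => 1 - \sum_i c i k) (unlift j i)); split=> [i|k].
  by rewrite mxE; case: unliftP => [p _|_] /=; [exact: cv|exact: xjP].
rewrite (bigD1_ord j)//= unlift_none/= -[RHS](subrK (\sum_i c i k)).
by congr (_ + _); apply: eq_bigr => i _; rewrite liftK.
Qed.

(** [G] is a compact subset of the open set of points with k-th digit 0, minus the countable set of
    cell ends. Half of [eps] pays for the complement of the open set, half for inner regularity;
    compactness provides [delta]. *)
Lemma large_zero_digit_set (eps : R) : 0 < eps -> exists k G delta,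
  [/\ 0 < delta, measurable G, ((1 - eps)%:E <= mu G)%E,
      forall x, G x -> exists c, coded c x &
      (forall x c, G x -> coded c x -> c k = 0) /\
      (forall x y c, G x -> coded c y -> c k <> 0 -> delta <= `|x - y|) ].
Proof.
move=> eps0; pose k := Num.truncn (2 / eps).
have k_eps : k.+2%:R^-1 <= eps / 2.
  rewrite -[leRHS]invrK lef_pV2 ?posrE ?invr_gt0 ?divr_gt0// invf_div.
  apply/ltW/(lt_trans (truncnS_gt _)).
  by rewrite ltr_nat.
pose O : set R := zero_digit k 0.
have mO : measurable O by apply: open_measurable; exact: open_zero_digit.
have O_itv : O `<=` `[0, 1[%classic.
  by move=> x /zero_digit_itv /andP[x0 x1]; rewrite /= in_itv/= ltW.
have muO : ((1 - eps / 2)%:E <= mu O)%E.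
  have : (mu `[0%R, 1%R[%classic <= mu (`[0%R, 1%R[%classic `\` O) + mu O)%E.
    rewrite -[in leLHS](setDUK O_itv) addeC; apply: measureU2 => //.
    exact: measurableD.
  rewrite lebesgue_measure_itv/= lte_fin ltr01 oppr0 adde0 => h.
  have : (mu (`[0%R, 1%R[%classic `\` O) <= (eps / 2)%:E)%E.
    by apply: le_trans (lebesgue_zero_digitC R k 0) _; rewrite lee_fin.
  move=> /(leeD2r (mu O))/(le_trans h).
  by rewrite addeC -leeBlDr.
have muO_fin : (mu O < +oo)%E.
  apply: (@le_lt_trans _ _ (mu `[0%R, 1%R[%classic)).
    by apply: le_measure; rewrite ?inE.
  by rewrite lebesgue_measure_itv/= lte_fin ltr01 -EFinB ltry.
have eps20 : 0 < eps / 2 by rewrite divr_gt0.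
have [V [cV VO muV]] := lebesgue_regularity_inner mO muO_fin eps20.
have [delta delta0 VOd] := compact_open_dist cV (@open_zero_digit R k 0) VO.
pose B : set R := range (fun s => iter_branch 0 s 0).
have countB : countable B.
  exact: sub_countable (card_image_le _ _) (countableP _).
have mB : measurable B by apply: countable_measurable.
have mV : measurable V by exact: compact_measurable.
exists k, (V `\` B), delta; split => //.
- exact: measurableD.
- have : (mu O <= mu (V `\` B) + (mu B + mu (O `\` V)))%E.
    apply: (@le_trans _ _ (mu ((V `\` B) `|` (B `|` (O `\` V))))).
      apply: le_measure; rewrite ?inE//.
        by apply: measurableU; [|apply: measurableU => //]; exact: measurableD.
      move=> x Ox; have [Vx|Vx] := pselect (V x); last by right; right.
      by have [Bx|Bx] := pselect (B x); [right; left|left].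
    have mVB : measurable (V `\` B) by exact: measurableD.
    have mOV : measurable (O `\` V) by exact: measurableD.
    have : (mu ((V `\` B) `|` (B `|` (O `\` V))) <=
            mu (V `\` B) + mu (B `|` (O `\` V)))%E.
      by apply: measureU2 => //; exact: measurableU.
    by move=> /le_trans; apply; apply: leeD => //; exact: measureU2.
  rewrite [mu B]countable_lebesgue_measure0// add0e => muO'.
  have := le_trans muO (le_trans muO' (leeD2l _ (ltW muV))).
  rewrite -leeBlDr// -EFinB; congr (_ <= _)%E; congr EFin; lra.
- move=> x [Vx Bx]; exact: coded_co_countable (zero_digit_itv (VO _ Vx)) Bx.
- split=> [x c [Vx _] cx|x y c [Vx _] cy ck].
    by apply/(coded_zero_digit k cx); exact: VO.
  by apply: VOd => // Oy; apply: ck; exact/(coded_zero_digit k cy).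
Qed.

Lemma hausdorff_code_antichain_approx (eps : R) : 0 < eps < 1 ->
  ((m.+1%:R * (1 - eps) ^+ m)%:E <= hausdorff_measure m%:R code_antichain)%E.
Proof.
move=> /andP[eps0 eps1].
have [k [G [delta [delta0 mG muG Gcode [G0 Gsep]]]]] := large_zero_digit_set eps0.
apply: (@le_trans _ _ (m.+1%:R%:E * mu G ^+ m)%E).
  rewrite EFinM lee_pmul2l// ?lte_fin// EFin_expe.
  elim: (m) => [|p IH]; first by rewrite !expe0.
  by rewrite !expeS lee_pmul// ?expe_ge0// lee_fin subr_ge0 ltW.
apply: (hausdorff_measure_ge delta0 mG) => [j v Gv|j l x y].
  have /choice[c cP] : forall i, exists c, coded c (v i).
    by move=> i; exact: Gcode.
  exact: code_antichain_full cP.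
move=> [[c [cx c1]] Gx] [_ Gy] jl.
have cj : c j k = 1.
  rewrite -(c1 k) (bigD1 j)//= big1 ?addr0// => i ij.
  exact: G0 (Gx i ij) (cx i).
(* The separation shows in coordinate [j] alone: there [x] has k-th digit 1, while [y] lies in [G]
   since j differs from l. *)
apply: (@le_trans _ _ `|y ord0 j - x ord0 j|).
  by apply: (Gsep _ _ _ (Gy j jl) (cx j)); rewrite cj.
rewrite distrC -sqrtr_sqr ler_wsqrtr// (bigD1 j)//= !mxE lerDl.
by rewrite sumr_ge0// => i _; exact: sqr_ge0.
Qed.

Lemma hausdorff_code_antichain_ge :
  (m.+1%:R%:E <= hausdorff_measure m%:R code_antichain)%E.
Proof.
have := hausdorff_code_antichain_approx.
have := hausdorff_antichain_le code_antichain_cube code_antichainP.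
have : (0 <= hausdorff_measure m%:R code_antichain)%E.
  apply: le_trans (@hausdorff_code_antichain_approx 2^-1 _); last by lra.
  by rewrite lee_fin mulr_ge0// exprn_ge0//; lra.
move: (hausdorff_measure _ _) => [h| |]// _ _ hP; rewrite lee_fin.
have bernoulli (p : nat) (t : R) : 0 <= t <= 1 -> 1 - p%:R * t <= (1 - t) ^+ p.
  move=> /andP[t0 t1]; elim: p => [|p IH]; first by rewrite mul0r subr0.
  rewrite exprS; apply: le_trans (ler_wpM2l _ IH); last lra.
  have : 0 <= p%:R * t ^+ 2 by rewrite mulr_ge0// sqr_ge0.
  by rewrite -natr1 => ?; nra.
apply/ler_addgt0Pr => eta eta0.
(* By Bernoulli's inequality the loss is at most (m+1) m t; the summand 2 keeps [C] positive when m
   = 0. *)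
pose C : R := m.+1%:R * m%:R + 2.
have C0 : 2 <= C by rewrite lerDr mulr_ge0.
pose t := Num.min 2^-1 (eta / C).
have t0 : 0 < t by rewrite lt_min invr_gt0 ltr0n divr_gt0//; lra.
have t1 : t <= 2^-1 by rewrite ge_min lexx.
have teta : t * C <= eta.
  by rewrite -ler_pdivlMr; [rewrite ge_min lexx orbT|lra].
have := hP t; rewrite t0 lee_fin /= => /(_ ltac:(lra)) ht.
have := bernoulli m t ltac:(lra).
rewrite -(@ler_pM2l _ m.+1%:R)// => hb.
have : m.+1%:R * (1 - m%:R * t) <= h by exact: le_trans hb ht.
move: teta; rewrite /C; lra.
Qed.

End code_antichain.

(** * Scaling to measure exactly n *)

Theorem theorem2 (R : realType) (n : nat) (hn : (1 <= n)%N) :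
  exists A : set 'rV[R]_n,
    [/\ A `<=` unit_cube R n,
        antichain A
      & hausdorff_measure (n%:R - 1) A = (n%:R)%:E].
Proof.
case: n hn => // m _.
rewrite (_ : m.+1%:R - 1 = m%:R :> R); last by rewrite -natr1 addrK.
have Acube := @code_antichain_cube R m; have Aanti := @code_antichainP R m.
have Age := @hausdorff_code_antichain_ge R m.
have Ale := hausdorff_antichain_le Acube Aanti.
set A := @code_antichain R m in Acube Aanti Age Ale.
(* For n = 1 the exponent is 0 and scaling has no effect, but the upper bound is then the
   0-dimensional ball volume 1 and meets the lower one. *)
case: m A Acube Aanti Age Ale => [|m] A Acube Aanti Age Ale.
  exists A; split=> //; apply/eqP; rewrite eq_le Age andbT.
  apply: le_trans Ale _; have := @ball_vol1E R 0.
  by rewrite /= ler01 !expr0 mul1r mulr1 => <-.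
have [h hE] : exists h : R, hausdorff_measure m.+1%:R A = h%:E.
  move: Age Ale; case: (hausdorff_measure _ _) => [h| |] //.
  by exists h.
move: Age; rewrite hE lee_fin => nh.
have h0 : 0 < h by rewrite (lt_le_trans _ nh).
pose lam : R := (m.+2%:R / h) `^ (m.+1%:R^-1).
have lam0 : 0 < lam by rewrite powR_gt0// divr_gt0.
have lamE : lam ^+ m.+1 = m.+2%:R / h.
  rewrite -powR_mulrn ?ltW// /lam -powRrM mulVf ?pnatr_eq0// powRr1//.
  by rewrite divr_ge0// ltW.
have lam1 : lam <= 1.
  by rewrite -(@expr_le1 _ m.+1) ?(ltW lam0)// lamE ler_pdivrMr// mul1r.
exists ( *:%R lam @` A); split.
- move=> _ [x Ax <-] i; rewrite mxE; have /andP[x0 x1] := Acube _ Ax i.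
  rewrite mulr_ge0 ?(ltW lam0)//=; nra.
- move=> _ _ [x Ax <-] [y Ay <-] xy lxy; apply: (Aanti x y) => //.
    by move=> xyE; apply: xy; rewrite xyE.
  by move=> i; have := lxy i; rewrite !mxE ler_pM2l.
- rewrite hausdorff_measureZ// lamE.
  by rewrite hE -EFinM divfK// lt0r_neq0.
Qed.
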